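(* For every integer $N\ge1$ and every field $\mathbb F$, there exists a finite connected simple graph $G_N$ such that \[ \kappa_{\min}(G_N)>0\qquad\text{and}\qquad H^{\mathrm{GLMY}}_N(G_N;\mathbb F)\neq0 . \] One may take $G_N=C_5^{\square N}$, the Cartesian product of $N$ copies of the five-cycle $C_5$.
   Context: Graphs are undirected and simple; $x\sim y$ denotes adjacency, $d$ is the graph distance, $d_x$ is the degree of $x$. **Cartesian product.** $G\square H$ has vertex set $V(G)\times V(H)$, with $(g,h)\sim(g',h')$ when either $g=g'$ and $\{h,h'\}\in E(H)$, or $h=h'$ and $\{g,g'\}\in E(G)$. **Lin--Lu--Yau curvature.** Let $G=(V,E)$ be a connected locally finite graph. For a vertex $x$ of positive degree and $\alpha\in[0,1]$ let $\mu_x^\alpha$ be the probability measure on $V$ with $\mu_x^\alpha(x)=\alpha$, $\mu_x^\alpha(z)=(1-\alpha)/d_x$ for $z\sim x$, and $\mu_x^\alpha(z)=0$ otherwise. For finitely supported probability measures $\mu,\nu$ on $V$, $W_1(\mu,\nu)=\inf_\pi\sum_{u,v}d(u,v)\pi(u,v)$, the infimum being over all couplings $\pi:V\times V\to[0,\infty)$ of $\mu$ and $\nu$. For distinct $x,y$ put $\kappa_\alpha(x,y)=1-W_1(\mu_x^\alpha,\mu_y^\alpha)/d(x,y)$ and $\kappa(x,y)=\lim_{\alpha\to1^-}\kappa_\alpha(x,y)/(1-\alpha)$ (the limit is known to exist). For a finite graph with at least one edge, $\kappa_{\min}(G)=\min_{\{x,y\}\in E(G)}\kappa(x,y)$. **GLMY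 path homology.** Let $\mathbb F$ be a field and $V$ a finite set. An elementary $p$-path is a symbol $e_{i_0\ldots i_p}$ with $i_0,\dots,i_p\in V$; it is regular if $i_{q-1}\ne i_q$ for $1\le q\le p$. Let $\mathcal R_p(V;\mathbb F)$ be the $\mathbb F$-vector space spanned by elementary $p$-paths modulo those that are not regular, with boundary $\partial e_{i_0\ldots i_p}=\sum_{q=0}^p(-1)^q e_{i_0\ldots\widehat{i_q}\ldots i_p}$, nonregular terms being set to zero, and $\partial=0$ on $0$-paths. For a finite digraph $D=(V,E_D)$, a regular elementary path $e_{i_0\ldots i_p}$ is allowed if $(i_{q-1},i_q)\in E_D$ for $1\le q\le p$; $\mathcal A_p(D;\mathbb F)\subseteq\mathcal R_p(V;\mathbb F)$ is the span of the allowed elementary $p$-paths, and $\Omega_p(D;\mathbb F)=\{u\in\mathcal A_p(D;\mathbb F):\partial u\in\mathcal A_{p-1}(D;\mathbb F)\}$ (with $\Omega_0=\mathcal A_0$). Then $\partial\Omega_p\subseteq\Omega_{p-1}$, and $H^{\mathrm{GLMY}}_p(D;\mathbb F)=\ker(\partial|_{\Omega_p})/\partial(\Omega_{p+1})$. For an undirected finite graph $G$, $H^{\mathrm{GLMY}}_p(G;\mathbb F)$ is defined as $H^{\mathrm{GLMY}}_p$ of the digraph obtained by replacing each edge $\{x,y\}$ by the two directed edges $(x,y)$ and $(y,x)$. *)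

(* Defs.v *)
From HB Require Import structures.
From mathcomp Require Import all_boot all_order all_algebra.
From mathcomp Require Import generic_quotient ring_quotient.
From mathcomp Require Import all_classical all_reals all_analysis.
Import Order.TTheory GRing.Theory Num.Theory.
Import numFieldNormedType.Exports.

Set Implicit Arguments.
Unset Strict Implicit.
Unset Printing Implicit Defensive.

Local Open Scope ring_scope.
Local Open Scope quotient_scope.
Local Open Scope classical_set_scope.

Record sgraph := SGraph {
  vertex :> finType;
  adj : rel vertex;
  adj_sym : symmetric adj;
  adj_irr : irreflexive adj }.

Definition connected_graph (G : sgraph) : Prop :=
  (0 < #|G|)%N /\ forall x y : G, connect (@adj G) x y.

Section BoxProduct.
Variables G H : sgraph.

Definition box_adj : rel (G * H) := fun u v =>
  ((u.1 == v.1) && adj u.2 v.2) || ((u.2 == v.2) && adj u.1 v.1).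

Lemma box_adj_sym : symmetric box_adj.
Proof.
by move=> u v; rewrite /box_adj adj_sym (adj_sym u.1) !(eq_sym (u.1)) !(eq_sym (u.2)).
Qed.

Lemma box_adj_irr : irreflexive box_adj.
Proof. by move=> u; rewrite /box_adj !adj_irr !andbF. Qed.

Definition box : sgraph := SGraph box_adj_sym box_adj_irr.

End BoxProduct.

Definition K1 : sgraph :=
  @SGraph unit (fun _ _ => false) (fun _ _ => erefl) (fun _ => erefl).

(* [box_power N G] is G □ (G □ ... □ G) with N factors (and K1 if N = 0). *)
Definition box_power (N : nat) (G : sgraph) : sgraph := iterop N box G K1.

(* [ordS i] is i + 1 modulo 5. *)
Definition C5_adj : rel 'I_5 := fun i j => (j == ordS i) || (i == ordS j).

Lemma C5_adj_sym : symmetric C5_adj.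
Proof. by move=> i j; rewrite /C5_adj orbC. Qed.

Lemma C5_adj_irr : irreflexive C5_adj.
Proof. by case=> [[|[|[|[|[|]]]]]]. Qed.

Definition C5 : sgraph := SGraph C5_adj_sym C5_adj_irr.

Section Curvature.
Variables (R : realType) (G : sgraph).

Definition degree (x : G) : nat := #|[pred y | adj x y]|.

(* The least length of a walk from x to y.  A shortest walk has fewer than #|G|
   edges; the value is #|G| if no walk exists. *)
Definition dist (x y : G) : nat :=
  find (fun k => [exists p : k.-tuple G, path (@adj G) x p && (last x p == y)])
       (iota 0 #|G|).

Definition mu (a : R) (x : G) : G -> R := fun z =>
  if z == x then a else if adj x z then (1 - a) / (degree x)%:R else 0.

Definition coupling (m n : G -> R) (w : G * G -> R) : Prop :=
  [/\ forall p, 0 <= w p,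
      forall u, \sum_v w (u, v) = m u &
      forall v, \sum_u w (u, v) = n v].

Definition W1 (m n : G -> R) : R :=
  inf [set \sum_p (dist p.1 p.2)%:R * w p | w in coupling m n].

Definition kappa_alpha (a : R) (x y : G) : R :=
  1 - W1 (mu a x) (mu a y) / (dist x y)%:R.

Definition kappa (x y : G) : R :=
  lim ((kappa_alpha a x y / (1 - a)) @[a --> (1 : R)^'-]).

(* The minimum over the edges; 0 by convention if G has no edge, so that
   [0 < kappa_min] entails that G has one. *)
Definition kappa_min : R :=
  if [pick e : G * G | adj e.1 e.2] is Some e0 then
    \big[Num.min/kappa e0.1 e0.2]_(e : G * G | adj e.1 e.2) kappa e.1 e.2
  else 0.

End Curvature.

Section VspaceQuotient.
Variables (K : fieldType) (V : vectType K) (U W : {vspace V}).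

Definition sub_vspace : {vspace subvs_of U} := (linfun (@vsval _ _ U) @^-1: W)%VS.

(* The quotient U / (U ∩ W), i.e. U / W when W is a subspace of U. *)
Definition vquot : Type :=
  Quotient.quot (sub_vspace : zmodClosed (subvs_of U)).

HB.instance Definition _ := GRing.Zmodule.on vquot.
HB.instance Definition _ := EqQuotient.on vquot.

Definition vquot_scale (a : K) (u : vquot) : vquot :=
  \pi_vquot (a *: repr u).

Lemma vquot_eqP (u v : subvs_of U) :
  reflect (\pi_vquot u = \pi_vquot v) (u - v \in sub_vspace).
Proof. by rewrite (Quotient.idealrBE sub_vspace); apply: eqP. Qed.

Lemma vquot_scale_pi a u : vquot_scale a (\pi_vquot u) = \pi_vquot (a *: u).
Proof.
apply/vquot_eqP; rewrite -scalerBr; apply: rpredZ.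
by apply/vquot_eqP; rewrite reprK.
Qed.

Lemma vquot_piD u v : \pi_vquot u + \pi_vquot v = \pi_vquot (u + v).
Proof. by symmetry; exact: Quotient.pi_add. Qed.

Fact vquot_scaleA a b u :
  vquot_scale a (vquot_scale b u) = vquot_scale (a * b) u.
Proof. by rewrite -[u]reprK (vquot_scale_pi b) !vquot_scale_pi scalerA. Qed.

Fact vquot_scale1 : left_id 1 vquot_scale.
Proof. by move=> u; rewrite -[u]reprK vquot_scale_pi scale1r. Qed.

Fact vquot_scaleDr : right_distributive vquot_scale +%R.
Proof.
move=> a u v; rewrite -[u]reprK -[v]reprK.
by rewrite vquot_piD !vquot_scale_pi vquot_piD scalerDr.
Qed.

Fact vquot_scaleDl u : {morph vquot_scale^~ u : a b / a + b}.
Proof.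
by move=> a b; rewrite -[u]reprK !vquot_scale_pi vquot_piD scalerDl.
Qed.

HB.instance Definition _ := GRing.Zmodule_isLmodule.Build K vquot
  vquot_scaleA vquot_scale1 vquot_scaleDr vquot_scaleDl.

End VspaceQuotient.

Section PathHomology.
Variables (F : fieldType) (V : finType).

(* [p.+1.-tuple V] indexes the elementary p-paths. *)
Definition regular p (t : p.+1.-tuple V) : bool :=
  sorted (fun x y => x != y) t.

(* Elementary paths modulo the nonregular ones, i.e. the vector space with basis
   the regular elementary paths. *)
Definition Rpath p : vectType F :=
  {ffun {t : p.+1.-tuple V | regular t} -> F^o}.

(* The class of an elementary path; it is 0 when t is not regular. *)
Definition elem p (t : p.+1.-tuple V) : Rpath p :=
  [ffun s => (val s == t)%:R].

Definition face p (q : 'I_p.+2) (t : p.+2.-tuple V) : p.+1.-tuple V :=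
  [tuple tnth t (lift q i) | i < p.+1].

Definition bd_fun p (u : Rpath p.+1) : Rpath p :=
  \sum_(t : {t : p.+2.-tuple V | regular t})
     u t *: \sum_(q < p.+2) (-1) ^+ q *: elem (face q (val t)).

Fact bd_fun_is_linear p : linear (@bd_fun p).
Proof.
move=> a u v; rewrite /bd_fun scaler_sumr -big_split /=.
by apply: eq_bigr => t _; rewrite !ffunE scalerDl scalerA.
Qed.

HB.instance Definition _ p :=
  GRing.isLinear.Build F (Rpath p.+1) (Rpath p) _ (@bd_fun p)
    (@bd_fun_is_linear p).

Definition bd p : 'Hom(Rpath p.+1, Rpath p) := linfun (@bd_fun p).

Section Digraph.
Variable E : rel V.

Definition allowed p (t : p.+1.-tuple V) : bool := regular t && sorted E t.

Definition Apath p : {vspace Rpath p} :=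
  <<[seq elem t | t in @allowed p]>>%VS.

Definition Omega p : {vspace Rpath p} :=
  if p is q.+1 then (Apath q.+1 :&: bd q @^-1: Apath q)%VS else Apath 0.

Definition cycles p : {vspace Rpath p} :=
  if p is q.+1 then (Omega q.+1 :&: lker (bd q))%VS else Omega 0.

Definition boundaries p : {vspace Rpath p} := (bd p @: Omega p.+1)%VS.

Definition GLMY_homology p : lmodType F := vquot (cycles p) (boundaries p).

End Digraph.
End PathHomology.

(* The symmetric relation [adj] is the edge relation of the digraph in which each
   edge {x, y} of G is replaced by (x, y) and (y, x). *)
Definition GLMY_homology_graph (F : fieldType) (G : sgraph) (p : nat)
  : lmodType F := GLMY_homology F (@adj G) p.

(* Main.v *)
From HB Require Import structures.
Require Import Defs.
From mathcomp Require Import all_boot all_order all_algebra all_fingroup.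
From mathcomp Require Import all_classical all_reals all_analysis.
From mathcomp Require Import zify ring lra.

(** The graph is the [N]-theta Cartesian power of the five-cycle, which is the Cayley
    graph of (Z/5)^N on the signed unit vectors ([torus_box_power]); everything is
    computed in these coordinates.

    Curvature.  For an edge from x to y = x + e, the two measures are compared
    by moving each neighbour x + d of x to y + d, which costs 1, except that
    x and y stay in place and x - e moves to y + e = x + 2 e.  In a
    five-cycle this last move has length 2 and not 3, and it is this shortcut that
    makes the curvature positive.  A potential depending only on the coordinate of
    the edge shows that the plan is optimal.  Hence, once the idleness a is close
    to 1, the transport distance is 1 - (1 - a) / d, where d = 2 N is the degree,
    and the curvature of every edge is exactly 1 / d ([kappa_edge],
    [kappa_torus]).

    Homology.  The class is the N-fold cross product of the fundamental cycle of
    the five-cycle, written out as the signed sum over all starting points v and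
    all permutations s of the lattice paths that leave v and step in directions
    s 0, s 1, ... ([cube_cycle]).  Its inner faces cancel in pairs under
    transpositions, its two outer faces under a cyclic shift ([bd_cube_cycle]).
    To see that it is not a boundary, let alpha_i count the signed crossings of
    one marked edge of the i-theta factor.  Since two points at distance two
    in the five-cycle have a single midpoint, alpha_i extends to pairs at distance
    two so as to be additive along two consecutive edges.  The cup product of the
    alpha_i therefore vanishes on the boundary of every allowed path
    ([cup_coboundary]), while exactly one term of the cycle has a nonzero
    value, namely 1 ([cup_lattice_path]).  The value is 1 in every field, whence
    a nonzero class in every characteristic ([GLMY_neq0]). *)

Import Order.TTheory GRing.Theory Num.Theory.
Import numFieldNormedType.Exports.
Set Implicit Arguments.
Unset Strict Implicit.
Unset Printing Implicit Defensive.
Local Open Scope ring_scope.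
Local Open Scope quotient_scope.
Local Open Scope classical_set_scope.

(** * Distance and walks *)

Section Distance.
Variable G : sgraph.
Implicit Types x y : G.

Lemma dist_le_walk x p : path (@adj G) x p -> (dist x (last x p) <= size p)%N.
Proof.
move=> xp; rewrite leqNgt; apply/negP => lt_p.
have := lt_p; rewrite /dist => /(before_find 0%N).
rewrite nth_iota; last first.
  by apply: leq_trans lt_p _; rewrite /dist -[leqRHS](size_iota 0) find_size.
move/negbT; rewrite negb_exists => /forallP/(_ (in_tuple p)).
by rewrite xp eqxx.
Qed.

Lemma dist_walk x y : connect (@adj G) x y ->
  exists p, [/\ path (@adj G) x p, last x p = y & size p = dist x y].
Proof.
case/connectP => p0 xp0 ->; case: (shortenP xp0) => p xp uxp _.
have lt_p : (size p < #|G|)%N.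
  by rewrite -[(size p).+1]/(size (x :: p)) -(card_uniqP uxp) max_card.
set P := fun k =>
  [exists q : k.-tuple G, path (@adj G) x q && (last x q == last x p)].
have hasP : has P (iota 0 #|G|).
  apply/hasP; exists (size p); first by rewrite mem_iota.
  by apply/existsP; exists (in_tuple p); rewrite xp eqxx.
have := nth_find 0%N hasP.
rewrite nth_iota -?[dist _ _]/(find P (iota 0 #|G|)); last first.
  by rewrite -[ltnRHS](size_iota 0 #|G|) -has_find.
case/existsP => q /andP[xq /eqP lq].
by exists q; rewrite size_tuple.
Qed.

Lemma dist_adj x y : adj x y -> dist x y = 1%N.
Proof.
move=> xy; have cxy : connect (@adj G) x y by apply: connect1.
apply/eqP; rewrite eqn_leq.
have /= -> := @dist_le_walk x [:: y]; last by rewrite /= xy.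
case: (dist_walk cxy) => [[|z p] [_ lp <-]] //.
by move: xy; rewrite -lp adj_irr.
Qed.

Lemma dist_xx x : dist x x = 0%N.
Proof. by apply/eqP; rewrite -leqn0 (@dist_le_walk x [::]). Qed.

(** Weak duality: a function that drops by at most one along each edge bounds
    the distance from below, hence transport costs too. *)
Lemma lipschitz_dist (f : G -> nat) x y : connect (@adj G) x y ->
  (forall u v : G, adj u v -> (f u <= f v + 1)%N) -> (f x <= f y + dist x y)%N.
Proof.
move=> /dist_walk[p [xp <- <-]] lip; elim: p x xp => [|z p IH] x /=.
  by rewrite addn0.
case/andP => /lip xz /IH zp; lia.
Qed.

End Distance.

(** * Curvature of an edge from an optimal coupling and a potential *)

Section EdgeCurvature.
Variables (R : realType) (G : sgraph).
Implicit Types x y : G.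

Definition closed_nbhd x : {set G} := [set z | (z == x) || adj x z].

Lemma sum_closed_nbhd (V : nmodType) x (F : G -> V) :
  \sum_(z in closed_nbhd x) F z = F x + \sum_(z | adj x z) F z.
Proof.
rewrite (bigD1 x) /=; last by rewrite inE eqxx.
congr (_ + _); apply: eq_bigl => z; rewrite inE andb_orl andbN /=.
by case: eqVneq => [->|_]; rewrite ?adj_irr ?andbT.
Qed.

Lemma card_closed_nbhd x : #|closed_nbhd x| = (degree x).+1.
Proof.
rewrite -sum1_card; apply: etrans (sum_closed_nbhd _ _) _.
by rewrite /degree -sum1_card -[RHS]add1n.
Qed.

(** When the excess weight [a - e] of the centre is nonnegative, this presents the
    measure as a point mass plus a uniform measure on the closed neighbourhood.
    Transport between two such measures then reduces to a matching of the closed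
    neighbourhoods. *)
Lemma mu_closed_nbhd (a : R) x z : let e := (1 - a) / (degree x)%:R in
  mu a x z = (a - e) * (z == x)%:R + e * (z \in closed_nbhd x)%:R.
Proof.
rewrite /mu inE /=; case: eqVneq => [->|_] /=; first by rewrite !mulr1 subrK.
by rewrite mulr0 add0r; case: adj; rewrite ?mulr1 ?mulr0.
Qed.

Lemma sum_mu (a : R) x (F : G -> R) : let e := (1 - a) / (degree x)%:R in
  \sum_z F z * mu a x z = (a - e) * F x + e * \sum_(z in closed_nbhd x) F z.
Proof.
move=> e; under eq_bigr do rewrite mu_closed_nbhd mulrDr.
rewrite big_split /=; congr (_ + _).
  rewrite (bigD1 x) //= eqxx mulr1 mulrC big1 ?addr0 // => z /negPf->.
  by rewrite !mulr0.
rewrite mulr_sumr [RHS]big_mkcond /=; apply: eq_bigr => z _.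
by case: (z \in _); rewrite ?mulr1 ?mulr0 // mulrC.
Qed.

Lemma sum_pair (F : G * G -> R) : \sum_p F p = \sum_u \sum_v F (u, v).
Proof. by rewrite pair_bigA /=; apply: eq_bigr => -[]. Qed.

(** The two halves of an optimality certificate for the edge [xy].  The matching
    [s] of closed neighbourhoods is a transport plan, hence an upper bound for the
    distance [W1]; the integer potential [f] is a dual solution, hence a lower
    bound.  The numerical hypotheses make the two bounds meet. *)
Section Certificate.
Variables (x y : G) (s : G -> G) (f : G -> nat).
Hypotheses (connG : connected_graph G) (xy : adj x y).
Hypothesis eq_deg : degree x = degree y.
Hypothesis s_inj : {in closed_nbhd x &, injective s}.
Hypothesis s_to : forall z, z \in closed_nbhd x -> s z \in closed_nbhd y.
Hypothesis s_cost : (\sum_(z in closed_nbhd x) dist z (s z) <= degree x)%N.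
Hypothesis f_lip : forall u v : G, adj u v -> (f u <= f v + 1)%N.
Hypothesis f_xy : f x = (f y + 1)%N.
Hypothesis f_sum :
  (\sum_(z | adj x z) f z + 1 = \sum_(z | adj y z) f z + degree x)%N.

Lemma degree_gt0 : (0 < degree x)%N.
Proof. by apply/card_gt0P; exists y. Qed.

Lemma imset_s : s @: closed_nbhd x = closed_nbhd y.
Proof.
apply/eqP; rewrite eqEcard card_in_imset // !card_closed_nbhd eq_deg leqnn andbT.
by apply/fintype.subsetP => _ /imsetP[z zx ->]; exact: s_to.
Qed.

(** The bound on [a] is what makes [a - e] nonnegative whatever the degree; only
    values of [a] close to 1 matter for the curvature. *)
Lemma W1_edge (a : R) : 1 / 2%:R <= a -> a <= 1 ->
  W1 (mu a x) (mu a y) = 1 - (1 - a) / (degree x)%:R.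
Proof.
move=> a_ge a_le; set d := (degree x)%:R; set e := (1 - a) / d.
have d_ge1 : 1 <= d :> R by rewrite /d ler1n degree_gt0.
have d_neq0 : d != 0 by apply: lt0r_neq0; apply: lt_le_trans d_ge1.
have ed : e * d = 1 - a by rewrite /e mulfVK.
have e_ge0 : 0 <= e by rewrite divr_ge0 ?subr_ge0 // ler0n.
have m_ge0 : 0 <= a - e.
  have : e <= e * d by rewrite ler_peMr.
  rewrite ed; lra.
pose S := [set \sum_p (dist p.1 p.2)%:R * w p | w in coupling (mu a x) (mu a y)].
(* Integrating the potential against any coupling bounds its cost below. *)
have lbS : lbound S (1 - e).
  move=> _ [w [w0 wx wy] <-].
  have fE (z z' : G) : degree z' = degree x -> z' = z ->
      \sum_u (f u)%:R * mu a z u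
        = (a - e) * (f z)%:R + e * \sum_(u in closed_nbhd z) (f u)%:R.
    by move=> dz zz; rewrite sum_mu /e /d -dz zz.
  have -> : 1 - e = \sum_u (f u)%:R * mu a x u - \sum_v (f v)%:R * mu a y v.
    rewrite (fE x x) // (fE y y) //.
    rewrite !sum_closed_nbhd f_xy.
    have := congr1 (fun k => k%:R : R) f_sum.
    rewrite !natrD !natr_sum -/d.
    set A := \sum_(_ | _) _; set B := \sum_(_ | _) _ => AB.
    have -> : A = B + d - 1 by rewrite -AB addrK.
    rewrite -[X in 1 - X](mulr1 e).
    transitivity (a + e * d - e); first by rewrite ed; ring.
    ring.
  have -> : \sum_u (f u)%:R * mu a x u = \sum_p (f p.1)%:R * w p.
    rewrite sum_pair.
    by apply: eq_bigr => u _; rewrite /= -mulr_sumr wx.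
  have -> : \sum_v (f v)%:R * mu a y v = \sum_p (f p.2)%:R * w p.
    rewrite sum_pair exchange_big /=.
    by apply: eq_bigr => v _; rewrite /= -mulr_sumr wy.
  rewrite -sumrB; apply: ler_sum => -[u v] _ /=; rewrite -mulrBl.
  apply: ler_wpM2r => //; rewrite lerBlDl -natrD ler_nat.
  exact: lipschitz_dist (connG.2 u v) f_lip.
(* The excess mass travels along the edge, the uniform part along [s]. *)
pose w (p : G * G) : R := (a - e) * ((p.1 == x) && (p.2 == y))%:R
  + e * ((p.1 \in closed_nbhd x) && (p.2 == s p.1))%:R.
have wC : coupling (mu a x) (mu a y) w.
  split.
  - by move=> p; rewrite addr_ge0 // mulr_ge0.
  - move=> u; rewrite mu_closed_nbhd -/e big_split /= -!mulr_sumr.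
    congr (_ * _ + _ * _).
      rewrite (bigD1 y) //= eqxx andbT big1 ?addr0 // => v /negPf->.
      by rewrite andbF.
    rewrite (bigD1 (s u)) //= eqxx andbT big1 ?addr0 // => v /negPf->.
    by rewrite andbF.
  - move=> v; rewrite mu_closed_nbhd -eq_deg -/e big_split /= -!mulr_sumr.
    congr (_ * _ + _ * _).
      by rewrite (bigD1 x) //= eqxx big1 ?addr0 // => u /negPf->.
    rewrite -imset_s; case: imsetP => [[u ux ->]|Nv] /=.
      rewrite (bigD1 u) //= ux eqxx big1 ?addr0 // => u' u'u.
      case: (boolP (u' \in closed_nbhd x)) => //= u'x.
      by rewrite (inj_in_eq s_inj) // eq_sym (negPf u'u).
    rewrite big1 // => u _; case: andP => // -[ux /eqP vE].
    by case: Nv; exists u.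
have wE : \sum_p (dist p.1 p.2)%:R * w p <= 1 - e.
  have -> : \sum_p (dist p.1 p.2)%:R * w p
      = (a - e) + e * (\sum_(u in closed_nbhd x) dist u (s u))%:R.
    under [LHS]eq_bigr do rewrite /w mulrDr.
    rewrite big_split /=; congr (_ + _).
      rewrite (bigD1 (x, y)) //= !eqxx mulr1 dist_adj // mul1r.
      rewrite big1 ?addr0 // => -[u v] /=.
      by rewrite xpair_eqE => /negPf->; rewrite mulr0 mulr0.
    rewrite natr_sum mulr_sumr [RHS]big_mkcond /=.
    rewrite sum_pair /=.
    apply: eq_bigr => u _; rewrite (bigD1 (s u)) //= eqxx andbT big1 ?addr0.
      by case: (u \in _); rewrite ?mulr1 ?mulr0 // mulrC.
    by move=> v /negPf->; rewrite andbF !mulr0.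
  have : e * (\sum_(u in closed_nbhd x) dist u (s u))%:R <= e * d.
    by rewrite ler_wpM2l // ler_nat.
  rewrite ed; lra.
rewrite /W1 -/S; apply/eqP; rewrite eq_le; apply/andP; split.
  apply: le_trans wE; apply: ge_inf; first by exists (1 - e).
  by exists w.
apply: lb_le_inf => //; by exists (\sum_p (dist p.1 p.2)%:R * w p); exists w.
Qed.

(** For [a] near 1 the quotient defining the curvature does not depend on [a], so
    its limit exists and is that constant. *)
Lemma kappa_edge : kappa R x y = (degree x)%:R^-1.
Proof.
apply: cvg_lim; first exact: Rhausdorff.
apply: cvg_near_cst; near=> a.
have a_lt1 : a < 1 by near: a; exact: nbhs_left_lt.
have a_ge : 1 / 2%:R <= a by near: a; apply: nbhs_left_ge; lra.
have a_neq1 : 1 - a != 0 by rewrite subr_eq0 gt_eqF.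
rewrite /kappa_alpha dist_adj // divr1 (W1_edge a_ge) ?ltW //.
by rewrite opprB addrC subrK mulrC mulKf.
Unshelve. all: by end_near.
Qed.

End Certificate.
End EdgeCurvature.

Lemma kappa_min_gt0 (R : realType) (G : sgraph) (x y : G) : adj x y ->
  (forall u v : G, adj u v -> 0 < kappa R u v) -> 0 < kappa_min R G.
Proof.
move=> xy k_gt0; rewrite /kappa_min; case: pickP => [e0 e0P|/(_ (x, y))]; last first.
  by rewrite /= xy.
apply: (big_ind (fun k => 0 < k)) => [|a b a0 b0|e /k_gt0 //].
  exact: k_gt0.
by rewrite lt_min a0.
Qed.

(** * Detecting a path homology class with a cochain *)

Section Pairing.
Variables (F : fieldType) (V : finType) (E : rel V).

Definition pairing p (phi : p.+1.-tuple V -> F) (u : Rpath F V p) : F :=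
  \sum_t u t * phi (val t).

Lemma pairing_is_linear p phi : linear (@pairing p phi : _ -> F^o).
Proof.
move=> a u v; rewrite /pairing scaler_sumr -big_split /=.
by apply: eq_bigr => t _; rewrite !ffunE mulrDl -mulrA.
Qed.

HB.instance Definition _ p phi :=
  GRing.isLinear.Build F (Rpath F V p) F^o _ (@pairing p phi)
    (@pairing_is_linear p phi).

Lemma pairing_sum p (phi : p.+1.-tuple V -> F) (I : finType)
    (c : I -> Rpath F V p) :
  pairing phi (\sum_i c i) = \sum_i pairing phi (c i).
Proof. exact: linear_sum. Qed.

Lemma pairingZ p (phi : p.+1.-tuple V -> F) a (c : Rpath F V p) :
  pairing phi (a *: c) = a * pairing phi c.
Proof. exact: linearZ. Qed.

Lemma pairing_elem p (phi : p.+1.-tuple V -> F) t :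
  (forall s, ~~ regular s -> phi s = 0) ->
  pairing phi (elem F t) = phi t.
Proof.
move=> phi0; rewrite /pairing; case: (boolP (regular t)) => [rt|Nrt].
  rewrite (bigD1 (exist _ t rt)) //= ffunE eqxx mul1r big1 ?addr0 // => s.
  by rewrite -val_eqE ffunE /= => /negPf->; rewrite mul0r.
rewrite phi0 // big1 // => s _; rewrite ffunE.
case: eqP => [st|]; last by rewrite mul0r.
by case/negP: Nrt; rewrite -st; exact: valP.
Qed.

Lemma bd_elem p (t : p.+2.-tuple V) : regular t ->
  bd F V p (elem F t) = \sum_(q < p.+2) (-1) ^+ q *: elem F (face q t).
Proof.
move=> rt; rewrite lfunE /= /bd_fun (bigD1 (exist _ t rt)) //= ffunE eqxx scale1r.
rewrite [X in _ + X]big1 ?addr0 // => s; rewrite -val_eqE ffunE /= => /negPf->.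
by rewrite scale0r.
Qed.

Lemma elem_Apath p (t : p.+1.-tuple V) : allowed E t -> elem F t \in Apath F E p.
Proof.
by move=> At; apply: memv_span; apply/fintype.imageP; exists t.
Qed.

(** A cochain that vanishes on the faces of allowed paths kills every boundary, so
    a cycle on which it does not vanish represents a nonzero class.  The closure
    condition is asked of single allowed paths, not only of elements of [Omega]:
    this is stronger than being a cocycle, but much easier to verify. *)
Lemma GLMY_neq0 p (c : Rpath F V p.+1) (phi : p.+2.-tuple V -> F) :
  c \in Apath F E p.+1 -> bd F V p c = 0 ->
  (forall s, ~~ regular s -> phi s = 0) ->
  (forall t : p.+3.-tuple V, allowed E t ->
     \sum_(q < p.+3) (-1) ^+ q * phi (face q t) = 0) ->
  pairing phi c != 0 ->
  exists h : GLMY_homology F E p.+1, h != 0.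
Proof.
move=> cA bc0 phi0 dphi pc.
have cZ : c \in cycles F E p.+1.
  rewrite /cycles memv_cap memv_ker bc0 eqxx andbT /Omega memv_cap cA /=.
  by rewrite -memv_preim bc0 mem0v.
have pair_bd w : w \in Apath F E p.+2 -> pairing phi (bd F V p.+1 w) = 0.
  move=> /coord_span ->; rewrite !linear_sum big1 // => i _.
  rewrite !linearZ /=.
  set b := (X in bd _ _ _ X); have : b \in [seq elem F t | t in @allowed V E p.+2].
    by rewrite /b mem_nth // size_image ltn_ord.
  case/fintype.imageP => t At ->; rewrite bd_elem; last by case/andP: At.
  rewrite [pairing _ _]linear_sum.
  rewrite (eq_bigr (fun q : 'I_p.+3 => (-1) ^+ q * phi (face q t))).
    by rewrite dphi // scaler0.
  by move=> q _; rewrite [LHS]linearZ /= pairing_elem.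
exists (\pi_(vquot (cycles F E p.+1) (boundaries F E p.+1)) (Subvs cZ)).
apply: contra_neq pc => h0.
have pi0 : \pi_(vquot (cycles F E p.+1) (boundaries F E p.+1)) 0 = 0 :> vquot _ _.
  by apply: (addrI (\pi_(vquot _ _) 0)); rewrite vquot_piD !addr0.
move: h0; rewrite -pi0 => /vquot_eqP; rewrite subr0 -memv_preim lfunE /=.
case/memv_imgP => w wO ->; apply: pair_bd.
by move: wO; rewrite memv_cap => /andP[].
Qed.
End Pairing.

(** * Cup products of degree one cochains *)

(** Each [alpha i] is a degree one cochain defined on all pairs of vertices, not
    only on edges: its values on pairs at distance two are what makes it additive
    along two-step allowed paths, which says that its coboundary vanishes there. *)
Section CupProduct.
Variables (F : fieldType) (V : finType) (E : rel V) (n : nat).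
Variable alpha : 'I_n.+1 -> V -> V -> F.
Hypothesis alpha_refl : forall i v, alpha i v v = 0.
Hypothesis alpha_add : forall i u v w, E u v -> E v w ->
  alpha i u w = alpha i u v + alpha i v w.

Definition cup (t : n.+2.-tuple V) : F :=
  \prod_(i < n.+1) alpha i (tnth t (widen_ord (leqnSn _) i)) (tnth t (lift ord0 i)).

Lemma cup_nonregular t : ~~ regular t -> cup t = 0.
Proof.
have x0 := thead t; move=> Nrt.
have [i it] : exists i : 'I_n.+1,
    tnth t (widen_ord (leqnSn _) i) == tnth t (lift ord0 i).
  apply/existsP; apply: contraNT Nrt => /existsPn ne.
  apply/(sortedP x0) => i; rewrite size_tuple ltnS => lt_i.
  by have := ne (Ordinal lt_i); rewrite !(tnth_nth x0).
by rewrite /cup (bigD1 i) //= (eqP it) alpha_refl mul0r.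
Qed.

(** The Leibniz rule in closed form.  Let [P k] be the product that skips the
    edge from [v k] to [v k.+1].  By additivity an inner face [q] contributes
    [P q.-1 + P q], and the two outer faces contribute [P 0] and [P n.+1], so the
    alternating sum telescopes. *)
Lemma cup_coboundary (t : n.+3.-tuple V) : allowed E t ->
  \sum_(q < n.+3) (-1) ^+ q * cup (face q t) = 0.
Proof.
case/andP => _; have x0 := thead t; move/(sortedP x0); rewrite size_tuple => Et.
pose v k := nth x0 t k.
pose P k := \prod_(i < n.+1) alpha i (v (i + (k <= i))%N) (v (i.+1 + (k <= i))%N).
have cupE (q : 'I_n.+3) : cup (face q t)
    = \prod_(i < n.+1) alpha i (v (bump q i)) (v (bump q i.+1)).
  by apply: eq_bigr => i _; rewrite !tnth_mktuple !(tnth_nth x0).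
have cup0 : cup (face ord0 t) = P 0.
  rewrite cupE; apply: eq_bigr => i _.
  by rewrite /bump /= [(1 + _)%N]addnC [(1 + i.+1)%N]addnC.
have cup_max : cup (face ord_max t) = P n.+1.
  rewrite cupE; apply: eq_bigr => i _ /=.
  by congr (alpha i (v _) (v _)); rewrite /bump; have := ltn_ord i; lia.
(* Inner faces are numbered from 1, whence the shift by one in [P]. *)
have cup_in (q : 'I_n.+1) :
    cup (face (lift ord0 (widen_ord (leqnSn _) q)) t) = P q + P q.+1.
  rewrite cupE (bigD1 q) // [P q](bigD1 q) // [P q.+1](bigD1 q) //=.
  set A := \prod_(_ | _) _; set B := \prod_(_ | _) _; set C := \prod_(_ | _) _.
  have -> : B = A.
    apply: eq_bigr => i; rewrite -val_eqE /= => iq.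
    by congr (alpha i (v _) (v _)); rewrite /bump; lia.
  have -> : C = A.
    apply: eq_bigr => i; rewrite -val_eqE /= => iq.
    by congr (alpha i (v _) (v _)); rewrite /bump; lia.
  rewrite -mulrDl leqnn ltnn; congr (_ * _).
  have -> : bump (bump 0 q) q = q by rewrite /bump; lia.
  have -> : bump (bump 0 q) q.+1 = q.+2 by rewrite /bump; lia.
  by rewrite !addn1 !addn0 addrC -alpha_add //; apply: Et; have := ltn_ord q; lia.
have telescope m : \sum_(q < m) (-1) ^+ q.+1 * (P q + P q.+1)
    = (-1) ^+ m * P m - P 0.
  elim: m => [|m IH]; first by rewrite big_ord0 expr0 mul1r subrr.
  by rewrite big_ord_recr /= IH exprS; ring.
rewrite big_ord_recl big_ord_recr /= cup0 expr0 mul1r.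
have -> : lift ord0 ord_max = ord_max :> 'I_n.+3 by apply: val_inj.
rewrite cup_max.
under eq_bigr do rewrite cup_in.
rewrite telescope [bump 0 n.+1]add1n [(-1) ^+ n.+2]exprS; ring.
Qed.

End CupProduct.

(** * The cycle of all monotone lattice paths in unit cubes *)

Section SignedSum.
Variables (F : fieldType) (W : lmodType F) (n : nat).

(** Multiplication by [s0] pairs even with odd permutations, so that the terms
    cancel without a division by two: the field may have characteristic two. *)
Lemma signed_sum_eq0 (X : 'S_n -> W) (s0 : 'S_n) : odd_perm s0 ->
  (forall s, X (s0 * s)%g = X s) -> \sum_(s : 'S_n) (-1) ^+ s *: X s = 0.
Proof.
move=> odd_s0 Xs0; rewrite (bigID (fun s : 'S_n => odd_perm s)) /=.
rewrite [X in X + _](reindex_inj (mulgI s0)) /=.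
apply/eqP; rewrite addr_eq0 -sumrN; apply/eqP; apply: eq_big => s.
  by rewrite odd_permM odd_s0.
by move=> _; rewrite odd_permM odd_s0 Xs0 signrN scaleNr.
Qed.
End SignedSum.

Section CubeCycle.
Variables (F : fieldType) (V : finType) (E : rel V) (M : zmodType) (n : nat).
Variables (act : M -> V -> V) (e : 'I_n.+1 -> M).
Hypothesis act0 : forall v, act 0 v = v.
Hypothesis actD : forall a b v, act (a + b) v = act a (act b v).
Hypothesis act_edge : forall i v, E v (act (e i) v) && (v != act (e i) v).

Definition lattice_path (v : V) (s : 'S_n.+1) : n.+2.-tuple V :=
  [tuple act (\sum_(j < n.+1 | (j < k)%N) e (s j)) v | k < n.+2].

(** The cross product of the [n.+1] one-dimensional cycles obtained by iterating a
    single step: over each unit cube it is the signed sum of the monotone lattice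
    paths from one corner to the opposite one. *)
Definition cube_cycle : Rpath F V n.+1 :=
  \sum_v \sum_(s : 'S_n.+1) (-1) ^+ s *: elem F (lattice_path v s).

Lemma partial_sum_recr (s : 'S_n.+1) (i : 'I_n.+1) :
  \sum_(j < n.+1 | (j < i.+1)%N) e (s j)
    = e (s i) + \sum_(j < n.+1 | (j < i)%N) e (s j).
Proof.
rewrite (bigD1 i) ?ltnSn //=; congr (_ + _); apply: eq_bigl => j.
by rewrite -val_eqE /=; lia.
Qed.

Lemma lattice_path_allowed v s : allowed E (lattice_path v s).
Proof.
have nE (k : 'I_n.+2) : nth v (lattice_path v s) k
    = act (\sum_(j < n.+1 | (j < k)%N) e (s j)) v.
  by rewrite -tnth_nth tnth_mktuple.
have step (i : nat) : (i.+1 < size (lattice_path v s))%N ->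
    let u := nth v (lattice_path v s) in
    E (u i) (u i.+1) && (u i != u i.+1).
  rewrite size_tuple => lt_i.
  have := nE (Ordinal lt_i); have := nE (Ordinal (ltnW lt_i)) => /= -> ->.
  by rewrite (partial_sum_recr s (Ordinal (lt_i : (i < n.+1)%N))) actD.
by apply/andP; split; apply/(sortedP v) => i /step/andP[].
Qed.

(** Exchanging two consecutive steps changes only the vertex between them, which
    the face [q] forgets. *)
Lemma face_swap v s (q : 'I_n.+2) : (0 < q < n.+1)%N ->
  face q (lattice_path v (tperm (inord q.-1) (inord q) * s)%g)
    = face q (lattice_path v s).
Proof.
move=> /andP[q_gt0 q_lt]; apply: eq_from_tnth => i; rewrite !tnth_mktuple.
congr (act _ v).
rewrite [RHS](reindex_inj (@perm_inj _ (tperm (inord q.-1) (inord q)))) /=.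
apply: eq_big => j; last by rewrite permM.
have iq : bump q i != q by rewrite /bump; lia.
case: tpermP => [->|->|//]; rewrite !inordK ?(leq_trans _ q_lt) //; lia.
Qed.

(* The cyclic permutation j |-> j + 1. *)
Let shift : 'S_n.+1 := lift_perm ord_max ord0 1.

(** Without its first vertex, a lattice path is the path that starts one step
    later, takes the steps in cyclically shifted order, and has lost its last
    vertex. *)
Lemma face_ends v s :
  face ord0 (lattice_path v s)
    = face ord_max (lattice_path (act (e (s ord0)) v) (shift * s)%g).
Proof.
apply: eq_from_tnth => i; rewrite !tnth_mktuple /= -actD; congr (act _ v).
rewrite addrC big_mkcond [X in _ = _ + X]big_mkcond big_ord_recl big_ord_recr /=.
have -> : (n < bump n.+1 i)%N = false by rewrite /bump; have := ltn_ord i; lia.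
rewrite addr0; congr (_ + _); apply: eq_bigr => j _.
have -> : widen_ord (leqnSn n) j = lift ord_max j.
  by apply: val_inj; rewrite /= /bump; have := ltn_ord j; lia.
rewrite permM lift_perm_lift perm1.
congr (if _ then _ else _).
by rewrite /= /bump; have := ltn_ord i; have := ltn_ord j; lia.
Qed.

(** Inner faces cancel in pairs, by exchanging two steps.  The two outer faces
    cancel after summation over all starting points: the cyclic permutation of
    [n.+1] steps has sign [(-1) ^+ n] while the last face carries the sign
    [(-1) ^+ n.+1]. *)
Lemma bd_cube_cycle : bd F V n cube_cycle = 0.
Proof.
have bdE v s : bd F V n (elem F (lattice_path v s))
    = \sum_(q < n.+2) (-1) ^+ q *: elem F (face q (lattice_path v s)).
  by rewrite bd_elem //; case/andP: (lattice_path_allowed v s).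
pose S (q : 'I_n.+2) : Rpath F V n :=
  \sum_v \sum_(s : 'S_n.+1) (-1) ^+ s *: elem F (face q (lattice_path v s)).
have -> : bd F V n cube_cycle = \sum_(q < n.+2) (-1) ^+ q *: S q.
  rewrite linear_sum /=.
  under eq_bigr do rewrite linear_sum /=.
  under [RHS]eq_bigr do rewrite scaler_sumr.
  rewrite [RHS]exchange_big; apply: eq_bigr => v _.
  under [RHS]eq_bigr do rewrite scaler_sumr.
  rewrite [RHS]exchange_big; apply: eq_bigr => s _.
  rewrite linearZ /= bdE scaler_sumr; apply: eq_bigr => q _.
  by rewrite !scalerA mulrC.
rewrite big_ord_recl big_ord_recr /= big1 ?add0r => [|q _]; last first.
  rewrite /S big1 ?scaler0 // => v _.
  set q' := lift _ _.
  apply: (@signed_sum_eq0 F _ n.+1 (fun s => elem F (face q' (lattice_path v s)))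
    (tperm (inord q'.-1) (inord q'))).
    rewrite odd_tperm -val_eqE /= !inordK ?add1n /bump; have := ltn_ord q; lia.
  by move=> s; rewrite face_swap //= /bump; have := ltn_ord q; lia.
have -> : S ord0 = (-1) ^+ n *: S ord_max.
  have act_inj a : injective (act a).
    by apply: (can_inj (g := act (- a))) => v; rewrite -actD addNr act0.
  rewrite /S exchange_big [in RHS]exchange_big /=.
  rewrite scaler_sumr [RHS](reindex_inj (mulgI shift)) /=.
  apply: eq_bigr => s _.
  rewrite scaler_sumr [RHS](reindex_inj (act_inj (e (s ord0)))) /=.
  apply: eq_bigr => v _; rewrite face_ends scalerA; congr (_ *: _).
  rewrite odd_permM odd_lift_perm odd_perm1 /= !addbF signr_addb signr_odd.
  by rewrite mulrA -exprMn mulrNN mulr1 expr1n mul1r.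
have -> : lift ord0 ord_max = ord_max :> 'I_n.+2 by apply: val_inj.
by rewrite expr0 scale1r exprS mulN1r scaleNr addrN.
Qed.

Lemma cube_cycle_Apath : cube_cycle \in Apath F E n.+1.
Proof.
apply: memv_suml => v _; apply: memv_suml => s _; apply: memvZ.
exact: elem_Apath (lattice_path_allowed v s).
Qed.

End CubeCycle.

(** * Coordinates on powers of the five-cycle *)

Section TorusCoordinates.

Definition unit_step n (p : 'I_n * bool) : 'rV['Z_5]_n :=
  (-1) ^+ p.2 *: delta_mx 0 p.1.

(** The graph is, through [theta], the Cayley graph of a power of Z/5 on the signed
    unit vectors.  In these coordinates all directions look alike, which hides
    the nesting of the iterated product. *)
Definition torus_coordinates n (G : sgraph) (theta : G -> 'rV['Z_5]_n) : Prop :=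
  bijective theta /\
  forall u v, adj u v = [exists p, theta v == theta u + unit_step p].

Lemma C5_adjE (i j : 'Z_5) :
  @adj C5 i j = [exists s : bool, j == i + (-1) ^+ s].
Proof.
have -> : [exists s : bool, j == i + (-1) ^+ s] = (j == i + 1) || (j == i - 1).
  apply/existsP/orP => [[[] ->]|[ji|ji]]; first by right.
  - by left.
  - by exists false.
  - by exists true.
by move: i j; do 2 case=> [[|[|[|[|[|//]]]]] ?].
Qed.

Lemma torus_C5 : torus_coordinates (fun a : C5 => const_mx (a : 'Z_5) : 'rV_1).
Proof.
split.
  exists (fun w : 'rV['Z_5]_1 => w 0 0) => [a|w]; first by rewrite mxE.
  by apply/rowP => j; rewrite mxE ord1.
move=> u v; rewrite C5_adjE; apply/existsP/existsP.
  case=> s /eqP vE; exists (ord0, s); apply/eqP/rowP => j.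
  by rewrite (ord1 j) vE !mxE !eqxx mulr1.
case=> -[i s] /eqP/rowP/(_ 0); rewrite (ord1 i) !mxE !eqxx mulr1 => vE.
by exists s; apply/eqP.
Qed.

Lemma torus_box_C5 n (H : sgraph) (theta : H -> 'rV['Z_5]_n) :
  torus_coordinates theta ->
  torus_coordinates (fun u : box C5 H =>
    row_mx (const_mx (u.1 : 'Z_5)) (theta u.2) : 'rV_(1 + n)).
Proof.
case=> -[eta thetaK etaK] adjE; split.
  exists (fun w : 'rV['Z_5]_(1 + n) => (lsubmx w 0 0 : C5, eta (rsubmx w))).
    by case=> a b /=; rewrite row_mxKl row_mxKr mxE thetaK.
  move=> w /=; rewrite etaK -[RHS]hsubmxK; congr row_mx.
  by apply/rowP => j; rewrite mxE ord1.
have theta_inj := can_inj thetaK.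
have stepl s : unit_step (lshift n (0 : 'I_1), s) = row_mx (const_mx ((-1) ^+ s)) 0.
  have <- : (-1) ^+ s *: delta_mx 0 0 = const_mx ((-1) ^+ s) :> 'rV['Z_5]_1.
    by apply/rowP => j; rewrite (ord1 j) !mxE !eqxx mulr1.
  by rewrite /unit_step /= delta_mx_lshift scale_row_mx scaler0.
have stepr i s : unit_step (rshift 1 i, s) = row_mx 0 (unit_step (i, s)).
  by rewrite /unit_step /= delta_mx_rshift scale_row_mx scaler0.
have const_inj (a b : 'Z_5) : (const_mx a == const_mx b :> 'rV_1) = (a == b).
  by apply/eqP/eqP => [/rowP/(_ 0)|->//]; rewrite !mxE.
case=> a b [a' b']; have -> : @adj (box C5 H) (a, b) (a', b')
  = ((a == a') && adj b b') || ((b == b') && @adj C5 a a') by [].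
rewrite adjE C5_adjE; apply/orP/existsP.
  case=> /andP[/eqP<- /existsP].
    by case=> -[i s] /eqP->; exists (rshift 1 i, s); rewrite stepr add_row_mx addr0.
  case=> s /eqP ->; exists (lshift n (0 : 'I_1), s); rewrite stepl add_row_mx addr0.
  by apply/eqP; congr row_mx; apply/rowP => j; rewrite !mxE.
case=> -[k s]; case: (split_ordP k) => i ->.
  rewrite ord1 stepl add_row_mx addr0 => /eqP/eq_row_mx/= [aE /theta_inj->].
  right; rewrite eqxx; apply/existsP; exists s; apply/eqP.
  by move/rowP/(_ 0): aE; rewrite !mxE.
rewrite stepr add_row_mx addr0 => /eqP/eq_row_mx/= [/eqP aE bE].
left; move: aE; rewrite const_inj eq_sym => ->.
by apply/existsP; exists (i, s); apply/eqP.
Qed.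

Lemma torus_box_power n :
  exists theta : box_power n.+1 C5 -> 'rV['Z_5]_n.+1, torus_coordinates theta.
Proof.
elim: n => [|n [theta thetaP]].
  by exists (fun a : C5 => const_mx (a : 'Z_5)); exact: torus_C5.
by eexists; exact: (torus_box_C5 thetaP).
Qed.

Lemma connected_torus n (G : sgraph) (theta : G -> 'rV['Z_5]_n) :
  torus_coordinates theta -> connected_graph G.
Proof.
case=> -[eta thetaK etaK] adjE; split.
  by apply/card_gt0P; exists (eta 0).
have cn (w : 'rV['Z_5]_n) x : connect (@adj G) x (eta (theta x + w)).
  rewrite [w]row_sum_delta; elim/big_rec: _ x => [|i w' _ IH] x.
    by rewrite addr0 thetaK.
  rewrite -[w 0 i]natr_Zp; elim: (w 0 i : nat) x => [|k IHk] x.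
    by rewrite scale0r add0r.
  apply: (@connect_trans _ _ (eta (theta x + delta_mx 0 i))).
    apply: connect1; rewrite adjE etaK; apply/existsP; exists (i, false).
    by rewrite /unit_step expr0 scale1r.
  have := IHk (eta (theta x + delta_mx 0 i)); rewrite etaK.
  by rewrite -addrA [delta_mx _ _ + _]addrA -[k.+1]add1n natrD scalerDl scale1r.
by move=> x y; have := cn (theta y - theta x) x; rewrite addrC subrK thetaK.
Qed.

End TorusCoordinates.

(** * Curvature of the discrete torus *)

Lemma unit_stepE n (p : 'I_n * bool) k :
  unit_step p 0 k = (-1) ^+ p.2 * (k == p.1)%:R.
Proof. by rewrite !mxE eqxx. Qed.

Lemma unit_step_inj n : injective (@unit_step n).
Proof.
move=> [i s] [j t] /rowP eq_st.
have := eq_st i; rewrite !unit_stepE /= eqxx mulr1.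
case: (eqVneq i j) => [<-|_]; last by case: s {eq_st}; rewrite mulr0.
by rewrite mulr1; case: s {eq_st}; case: t.
Qed.

Lemma unit_stepN n (i : 'I_n) s : unit_step (i, ~~ s) = - unit_step (i, s).
Proof. by rewrite /unit_step /= signrN scaleNr. Qed.

(** The potential on the five-cycle for the edge from 0 to 1.  It drops by one
    along that edge and by two, the largest possible value, from 4 to 2: it is
    tight on every pair of points that the optimal plan joins. *)
Definition height (a : 'Z_5) : nat := nth 0%N [:: 1; 0; 0; 1; 2]%N a.

Lemma height_lip (a b c : 'Z_5) : a = b + c -> c \in [:: 0; 1; -1] ->
  (height a <= height b + 1)%N.
Proof.
move=> ->; rewrite !inE => /or3P[] /eqP->;
  by move: b; case=> [[|[|[|[|[|//]]]]] ?].
Qed.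

Section TorusEdge.
Variables (n : nat) (G : sgraph) (theta : G -> 'rV['Z_5]_n) (eta : 'rV['Z_5]_n -> G).
Hypotheses (thetaK : cancel theta eta) (etaK : cancel eta theta).
Hypothesis adjE : forall u v, adj u v = [exists p, theta v == theta u + unit_step p].

Let nb (x : G) p : G := eta (theta x + unit_step p).

Lemma nb_inj (x : G) : injective (nb x).
Proof. by move=> p q /(can_inj etaK)/addrI/unit_step_inj. Qed.

Lemma sum_nb (V : nmodType) (F : G -> V) (x : G) :
  \sum_(z | adj x z) F z = \sum_p F (nb x p).
Proof.
rewrite -(big_imset (fun z => F z) (in2W (@nb_inj x))) /=.
apply: eq_bigl => z; rewrite adjE; apply/existsP/imsetP => -[p].
  by move/eqP=> zE; exists p => //; rewrite /nb -zE thetaK.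
by move=> _ ->; exists p; rewrite etaK.
Qed.

Lemma adj_nb (x : G) p : adj x (nb x p).
Proof. by rewrite adjE etaK; apply/existsP; exists p. Qed.

Lemma degree_torus (x : G) : degree x = #|{: 'I_n * bool}|.
Proof. by rewrite /degree -!sum1_card; apply: etrans (sum_nb _ _) _. Qed.

(** Let [y = x + e].  The plan moves each neighbour [x + d] to [y + d] at cost 1,
    except along the line of the edge: there [x] and [y] stay, and [x - e] goes to
    [y + e = x + 2 e], at distance 2 because [5 e = 0].  In total this is the
    degree.  On a line the last move would cost 3 and the curvature
    would vanish.  The potential is [height] on the coordinate of the edge,
    oriented and centred so that [x] is at 0 and [y] at 1. *)
Lemma kappa_torus (R : realType) (x y : G) :
  connected_graph G -> adj x y -> kappa R x y = (degree x)%:R^-1.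
Proof.
move=> connG xy.
have [[i s] /eqP yE] : exists p, theta y == theta x + unit_step p.
  by apply/existsP; rewrite -adjE.
set e := unit_step (i, s) in yE.
have eE k : e 0 k = (-1) ^+ s * (k == i)%:R by rewrite unit_stepE.
have eP : unit_step (i, s) = e by [].
have y_nb : y = nb x (i, s) by rewrite /nb -yE thetaK.
clearbody e.
have addE (u v : 'rV['Z_5]_n) k : (u + v) 0 k = u 0 k + v 0 k by rewrite mxE.
have ss : (-1) ^+ s * (-1) ^+ s = 1 :> 'Z_5 by rewrite -expr2 sqrr_sign.
pose f z := height ((-1) ^+ s * (theta z 0 i - theta x 0 i)).
have f_nb z p : f (nb z p) = height ((-1) ^+ s * (theta z 0 i - theta x 0 i)
    + (-1) ^+ (s (+) p.2) * (i == p.1)%:R).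
  rewrite /f etaK mxE unit_stepE signr_addb -mulrA -mulrDr.
  by congr (height (_ * _)); rewrite addrAC.
have f_nbx p : f (nb x p) = height ((-1) ^+ (s (+) p.2) * (i == p.1)%:R).
  by rewrite f_nb subrr mulr0 add0r.
have f_nby p : f (nb y p) = height (1 + (-1) ^+ (s (+) p.2) * (i == p.1)%:R).
  rewrite f_nb; congr (height (_ + _)).
  by rewrite yE mxE addrAC subrr add0r eE eqxx mulr1 ss.
have fx : f x = 1%N by rewrite /f subrr mulr0.
have fy : f y = 0%N by rewrite y_nb f_nbx addbb eqxx mulr1 expr0.
(* Reflecting the coordinate of the edge exchanges [x] and [y], and [x - e] with
   [y + e]; on the other neighbours of [x] it is the translation by [e].  It is an
   involution preserving the pair [x], [y], so it stays injective when changed to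
   the identity on that pair. *)
pose rho z :=
  eta (theta z + (theta x 0 i + theta y 0 i - theta z 0 i *+ 2) *: delta_mx 0 i).
have theta_rho z k : theta (rho z) 0 k
    = if k == i then theta x 0 i + theta y 0 i - theta z 0 i else theta z 0 k.
  rewrite etaK !mxE eqxx /=; case: eqVneq => [->|_]; last by rewrite mulr0 addr0.
  by rewrite mulr1; ring.
have rhoK : involutive rho.
  move=> z; apply: (can_inj thetaK); apply/rowP => k.
  by rewrite !theta_rho eqxx; case: eqVneq => [->|//]; ring.
have rho_x : rho x = y.
  apply: (can_inj thetaK); apply/rowP => k; rewrite theta_rho.
  case: eqVneq => [->|ki]; first by ring.
  by rewrite yE mxE eE (negPf ki) mulr0 addr0.
have rho_y : rho y = x by rewrite -rho_x rhoK.
pose plan z := if z \in pred2 x y then z else rho z.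
have plan_nb (p : 'I_n * bool) : p != (i, s) ->
    plan (nb x p) = nb y (if p == (i, ~~ s) then (i, s) else p).
  move=> p_neq; rewrite /plan ifN; last first.
    rewrite !inE negb_or [in _ == y]y_nb (inj_eq (@nb_inj x)) p_neq andbT.
    by apply: contraTneq (adj_nb x p) => ->; rewrite adj_irr.
  apply: (can_inj thetaK); apply/rowP => k; rewrite theta_rho !etaK.
  case: (eqVneq p (i, ~~ s)) => [->|p_neq'].
    rewrite yE unit_stepN eP !mxE !eE.
    by case: eqVneq => [->|_]; rewrite ?eqxx ?mulr1 ?mulr0; ring.
  have p_i : i != p.1.
    case: p p_neq p_neq' => j t /=; rewrite !xpair_eqE negb_and.
    by case: eqVneq => //= _; case: (s); case: (t).
  rewrite yE !addE !eE !unit_stepE (negPf p_i).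
  by case: eqVneq => [->|_]; rewrite ?eqxx ?(negPf p_i) ?mulr1 ?mulr0; ring.
have one q : (\sum_(p : 'I_n * bool) (p == q) = 1)%N.
  by rewrite (bigD1 q) //= eqxx big1 // => p /negPf->.
apply: (@kappa_edge R G x y plan f) => //.
- by rewrite !degree_torus.
- move=> z w _ _; rewrite /plan.
  have stab u : (rho u \in pred2 x y) = (u \in pred2 x y).
    by rewrite !inE -{1}rho_y -{2}rho_x !(can_eq rhoK) orbC.
  case: ifPn => zP; case: ifPn => wP //; last exact: (can_inj rhoK).
    by move=> zE; rewrite zE stab (negPf wP) in zP.
  by move=> wE; rewrite -wE stab (negPf zP) in wP.
- move=> z; rewrite !inE => /orP[/eqP->|].
    by rewrite /plan !inE eqxx /= adj_sym xy orbT.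
  rewrite adjE => /existsP[p /eqP zE].
  have -> : z = nb x p by rewrite /nb -zE thetaK.
  case: (eqVneq p (i, s)) => [->|p_neq].
    by rewrite -y_nb /plan !inE eqxx orbT eqxx.
  rewrite plan_nb //; apply/orP; right; rewrite adjE; apply/existsP.
  by eexists; rewrite etaK.
- rewrite [leqLHS]sum_closed_nbhd sum_nb degree_torus.
  have -> : plan x = x by rewrite /plan !inE eqxx.
  (* The indicators record the cost 0 of [y] and the cost 2 of [x - e]; both sum
     to one. *)
  rewrite dist_xx add0r -(leq_add2r 1) -{1}(one (i, s)) -(one (i, ~~ s)).
  rewrite -sum1_card -!big_split; apply: leq_sum => p _ /=.
  case: (eqVneq p (i, s)) => [->|p_neq].
    by rewrite -y_nb /plan !inE eqxx orbT dist_xx.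
  rewrite plan_nb // addn0; case: eqVneq => [->|p_neq'] /=.
    (* Two steps backwards lead from [x - e] to [x - 3 e = x + 2 e]. *)
    set w := nb (nb x (i, ~~ s)) (i, ~~ s).
    have <- : nb w (i, ~~ s) = nb y (i, s).
      congr eta; rewrite !etaK yE !unit_stepN eP; apply/rowP => k; rewrite !mxE.
      have e5 : e 0 k *+ 5 = 0.
        by case: (e 0 k) => [[|[|[|[|[|//]]]]] ?]; exact: val_inj.
      by apply/eqP; rewrite -subr_eq0 -oppr_eq0 -e5; apply/eqP; ring.
    have := @dist_le_walk G (nb x (i, ~~ s)) [:: w; nb w (i, ~~ s)].
    by rewrite /= !adj_nb; exact.
  rewrite dist_adj // adjE; apply/existsP; exists (i, s).
  by rewrite !etaK yE eP addrAC.
- move=> u v; rewrite adjE => /existsP[[j t] /eqP vE].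
  apply: (@height_lip _ _ (- ((-1) ^+ s * unit_step (j, t) 0 i))).
    by rewrite vE mxE; ring.
  rewrite unit_stepE; case: (_ == _); last by rewrite !mulr0 oppr0.
  by rewrite !inE; case: (s); case: (t).
- by rewrite fx fy.
(* The potentials of [x + d] and [y + d] differ by one, except for [d = e],
   where both are 0. *)
- rewrite !sum_nb degree_torus -{1}(one (i, s)) -sum1_card -!big_split.
  apply: eq_bigr => -[j t] _ /=; rewrite f_nbx f_nby xpair_eqE eq_sym /=.
  by case: (_ == _); case: (s); case: (t).
Qed.
End TorusEdge.

(** * A nonzero homology class on the discrete torus *)

(** The signed number of times that a shortest walk from [a] to [b] in the
    five-cycle crosses the edge from 0 to 1.  A single marked edge, rather than the
    class that counts all edges, makes the value on the fundamental cycle 1 and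
    not 5, which matters in characteristic five. *)
Definition crossing (a b : 'Z_5) : int :=
  let up := [:: (0, 1); (0, 2); (4, 1)]%N in
  (((a : nat, b : nat) \in up) : nat)%:Z - (((b : nat, a : nat) \in up) : nat)%:Z.

Lemma crossing_refl a : crossing a a = 0.
Proof. exact: subrr. Qed.

Lemma crossing_succ a : crossing a (a + 1) = (a == 0)%:Z.
Proof. by case: a => [[|[|[|[|[|//]]]]] ?]. Qed.

(** Length five is used here: two points at distance two have a unique midpoint,
    so the value on such a pair is forced consistently. *)
Lemma crossing_add (a b c d d' : 'Z_5) :
  d \in [:: 0; 1; -1] -> d' \in [:: 0; 1; -1] -> b = a + d -> c = b + d' ->
  crossing a c = crossing a b + crossing b c.
Proof.
rewrite !inE => /or3P[] /eqP -> /or3P[] /eqP -> -> ->;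
  by case: a => [[|[|[|[|[|//]]]]] ?].
Qed.

Section TorusHomology.
Variables (F : fieldType) (n : nat) (G : sgraph).
Variables (theta : G -> 'rV['Z_5]_n.+1) (eta : 'rV['Z_5]_n.+1 -> G).
Hypotheses (thetaK : cancel theta eta) (etaK : cancel eta theta).
Hypothesis adjE : forall u v, adj u v = [exists p, theta v == theta u + unit_step p].

Let alpha i (u v : G) : F := (crossing (theta u 0 i) (theta v 0 i))%:~R.
Let act w (x : G) := eta (theta x + w).
Let e i : 'rV['Z_5]_n.+1 := unit_step (i, false).

Lemma alpha_refl i v : alpha i v v = 0.
Proof. by rewrite /alpha crossing_refl. Qed.

Lemma alpha_add i u v w : adj u v -> adj v w ->
  alpha i u w = alpha i u v + alpha i v w.
Proof.
rewrite !adjE => /existsP[p /eqP vE] /existsP[q /eqP wE].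
have step_in r : unit_step r 0 i \in [:: 0; 1; -1].
  rewrite unit_stepE; case: (_ == _); last by rewrite mulr0.
  by case: (r.2).
rewrite /alpha -rmorphD; congr _%:~R.
apply: (crossing_add (step_in p) (step_in q)); first by rewrite vE mxE.
by rewrite wE mxE.
Qed.

Lemma act0 v : act 0 v = v. Proof. by rewrite /act addr0 thetaK. Qed.

Lemma actD a b v : act (a + b) v = act a (act b v).
Proof. by rewrite /act etaK addrAC -addrA. Qed.

Lemma act_edge i v : adj v (act (e i) v) && (v != act (e i) v).
Proof.
have vv : adj v (act (e i) v).
  by rewrite adjE etaK; apply/existsP; exists (i, false).
by rewrite vv; apply: contraTneq vv => <-; rewrite adj_irr.
Qed.

(** The cochain [alpha i] only sees steps in direction [i] that leave the
    hyperplane where coordinate [i] is 0.  So the cup product forces the steps to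
    come in the standard order, and the starting point to be the origin. *)
Lemma cup_lattice_path v (s : 'S_n.+1) :
  cup alpha (lattice_path act e v s) = ((s == 1%g) && (theta v == 0))%:R.
Proof.
have factor i : let c := theta v 0 i + \sum_(j < n.+1 | (j < i)%N) e (s j) 0 i in
    alpha i (tnth (lattice_path act e v s) (widen_ord (leqnSn _) i))
            (tnth (lattice_path act e v s) (lift ord0 i))
    = (crossing c (c + (i == s i)%:R))%:~R.
  move=> c; rewrite !tnth_mktuple /= /bump /= add1n partial_sum_recr /alpha !etaK.
  have addE (u w : 'rV['Z_5]_n.+1) : (u + w) 0 i = u 0 i + w 0 i by rewrite mxE.
  rewrite !addE summxE -/c unit_stepE /= expr0 mul1r.
  by congr (crossing _ _)%:~R; rewrite addrCA addrC.
rewrite /cup (eq_bigr _ (fun i _ => factor i)).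
case: eqVneq => [->|s_neq1] /=; last first.
  have [i si] : exists i, s i != i.
    apply/existsP; apply: contraNT s_neq1 => /existsPn sE.
    by apply/eqP/permP => i; rewrite perm1; apply/eqP; rewrite -[_ == _]negbK.
  by rewrite (bigD1 i) //= eq_sym (negPf si) addr0 crossing_refl mul0r.
have cE (i : 'I_n.+1) :
    theta v 0 i + \sum_(j < n.+1 | (j < i)%N) e ((1%g : 'S_n.+1) j) 0 i
      = theta v 0 i.
  rewrite big1 ?addr0 // => j ji; rewrite perm1 unit_stepE /=.
  by rewrite -val_eqE /= gtn_eqF // mulr0.
under eq_bigr do rewrite cE perm1 eqxx crossing_succ.
case: eqVneq => [->|v_neq0].
  by rewrite big1 // => i _; rewrite mxE.
have [i vi] : exists i, theta v 0 i != 0.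
  apply/existsP; apply: contraNT v_neq0 => /existsPn vE.
  by apply/eqP/rowP => i; rewrite mxE; apply/eqP; rewrite -[_ == _]negbK.
by rewrite (bigD1 i) //= (negPf vi) mul0r.
Qed.

Lemma torus_homology_neq0 :
  exists h : GLMY_homology_graph F G n.+1, h != 0.
Proof.
apply: (@GLMY_neq0 F G (@adj G) n (cube_cycle F act e) (cup alpha)).
- exact: cube_cycle_Apath actD act_edge.
- exact: bd_cube_cycle act0 actD act_edge.
- exact: cup_nonregular alpha_refl.
- exact: cup_coboundary alpha_add.
have cube_pair v : pairing (cup alpha)
      (\sum_(s : 'S_n.+1) (-1) ^+ s *: elem F (lattice_path act e v s))
    = (theta v == 0)%:R.
  rewrite pairing_sum (bigD1 1%g) //= [X in _ + X]big1 => [|s /negPf s1].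
    rewrite pairingZ pairing_elem; last exact: cup_nonregular alpha_refl.
    by rewrite cup_lattice_path eqxx odd_perm1 expr0 mul1r addr0.
  rewrite pairingZ pairing_elem; last exact: cup_nonregular alpha_refl.
  by rewrite cup_lattice_path s1 mulr0.
suff -> : pairing (cup alpha) (cube_cycle F act e) = 1 by exact: oner_neq0.
rewrite pairing_sum (bigD1 (eta 0)) //= cube_pair etaK eqxx.
rewrite big1 ?addr0 // => v v0; rewrite cube_pair.
case: eqP => // vE; by case/eqP: v0; rewrite -vE thetaK.
Qed.
End TorusHomology.

Theorem corollary5p3 (R : realType) (F : fieldType) (N : nat) (hN : (1 <= N)%N) :
  (exists G : sgraph,
     [/\ connected_graph G,
         0 < kappa_min R G &
         exists c : GLMY_homology_graph F G N, c != 0])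
  /\
  [/\ connected_graph (box_power N C5),
      0 < kappa_min R (box_power N C5) &
      exists c : GLMY_homology_graph F (box_power N C5) N, c != 0].
Proof.
suff C5P : [/\ connected_graph (box_power N C5),
      0 < kappa_min R (box_power N C5) &
      exists c : GLMY_homology_graph F (box_power N C5) N, c != 0].
  by split=> //; exists (box_power N C5).
case: N hN => // n _; have [theta thetaP] := torus_box_power n.
have conn := connected_torus thetaP; case: thetaP => -[eta thetaK etaK] adjE.
split=> //; last exact: torus_homology_neq0 thetaK etaK adjE.
have kE := kappa_torus thetaK etaK adjE R conn.
apply: (kappa_min_gt0 (adj_nb etaK adjE (eta 0) (ord0, false))) => u v uv.
by rewrite (kE _ _ uv) invr_gt0 ltr0n; apply: degree_gt0 uv.
Qed.
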